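(* Let $a>0$, $b>0$. Then $\left(a,\,b,\,a+b-\frac12\right)\in\mathcal{P}_{1,2}$ if and only if $b>a+\frac12$. Moreover, in this case, for all $x>0$, $${}_1F_2\left(a\,;b,\,a+b-\tfrac12\,;-\tfrac{x^2}{4}\right)>\mathbb{J}_{b-1}^2\left(\frac{x}{2}\right).$$
   Context: For $a,b,c>0$, ${}_1F_2\left(a\,;b,c\,;-\frac{x^2}{4}\right)=\sum_{k=0}^\infty \frac{(a)_k}{k!\,(b)_k(c)_k}\left(-\frac{x^2}{4}\right)^k$, where $(\alpha)_k=\Gamma(\alpha+k)/\Gamma(\alpha)$. $\mathcal{P}_{1,2}$ denotes the set of all triples $(a,b,c)$ of positive reals such that this function is $>0$ for all $x>0$. For $\alpha>-1$, $\mathbb{J}_\alpha(x)={}_0F_1\left(\alpha+1\,;-\frac{x^2}{4}\right)=\Gamma(\alpha+1)(x/2)^{-\alpha}J_\alpha(x)$, with $J_\alpha$ the Bessel function of the first kind. *)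

(* Defs.v *)
From Stdlib Require Import Reals Arith Factorial.
From Coquelicot Require Import Coquelicot.
Open Scope R_scope.

(* Pochhammer symbol (alpha)_k = Gamma(alpha+k)/Gamma(alpha), written as the
   rising factorial alpha (alpha+1) ... (alpha+k-1) (equal for alpha > 0). *)
Fixpoint poch (alpha : R) (k : nat) : R :=
  match k with
  | O => 1
  | S k' => poch alpha k' * (alpha + INR k')
  end.

Definition F12 (a b c x : R) : R :=
  Series (fun k => poch a k / (INR (fact k) * poch b k * poch c k)
                   * (- x ^ 2 / 4) ^ k).

Definition P12 (a b c : R) : Prop :=
  0 < a /\ 0 < b /\ 0 < c /\ forall x, 0 < x -> 0 < F12 a b c x.

(* Normalized Bessel function  J_alpha(x) = 0F1(alpha+1; -x^2/4). *)
Definition BJ (alpha x : R) : R :=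
  Series (fun k => (- x ^ 2 / 4) ^ k / (INR (fact k) * poch (alpha + 1) k)).

(* Main.v *)
Require Import Defs.
From Stdlib Require Import Reals Factorial Lra Lia.
From Coquelicot Require Import Coquelicot.
Open Scope R_scope.

(* Put [beta = b - 1/2] and [c = a + beta]. Gasper's expansion in squares of
   Bessel functions reads, for [b > 1/2],
     F(a; b, c; -x^2/4)
       = sum_n A_n (beta - a)_n / ((c)_n (b)_n^2) (x/4)^(2n) J_{b-1+n}(x/2)^2
   with [A_n > 0] ([A_0 = 1]); the coefficient comes out in closed form since
   the underlying 3F2 is Saalschuetzian. For [b > a + 1/2] every term is
   nonnegative and the first one is [J_{b-1}(x/2)^2].
   Conversely, since [d/dy (y^b F(a; b+1, c; -y)) = b y^(b-1) F(a; b, c; -y)],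
   positivity is preserved by [b -> b + 1] and by [c -> c + 1], which reduces
   the necessity to [a - 1/2 < b <= a + 1/2]. There all the terms with [n >= 1]
   are nonpositive, so F is nonpositive where [J_{b-1}(x/2)] vanishes; when
   [b <= 1/2] the first three terms of the power series already show that F
   takes a negative value. *)

(** * Rising factorials *)

Lemma poch_pos (x : R) (k : nat) : 0 < x -> 0 < poch x k.
Proof.
  intros Hx; induction k as [|k IH]; simpl; [lra|].
  pose proof (pos_INR k); apply Rmult_lt_0_compat; lra.
Qed.

Lemma poch_add (x : R) (n m : nat) :
  poch x (n + m) = poch x n * poch (x + INR n) m.
Proof.
  induction m as [|m IH].
  - rewrite Nat.add_0_r; simpl; ring.
  - rewrite Nat.add_succ_r; simpl; rewrite IH, plus_INR; ring.
Qed.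

Lemma poch_S_l (x : R) (k : nat) : poch x (S k) = x * poch (x + 1) k.
Proof.
  replace (S k) with (1 + k)%nat by lia; rewrite poch_add; simpl.
  replace (x + 0) with x by ring; ring.
Qed.

(** Duplication formula: the factors [2 x + 2 n] and [2 x + 2 n + 1] pair up as
    [4 (x + n) (x + 1 / 2 + n)]. *)
Lemma poch_double (x : R) (n : nat) :
  poch (2 * x) (2 * n) = 4 ^ n * poch x n * poch (x + 1 / 2) n.
Proof.
  induction n as [|n IH]; [simpl; ring|].
  replace (2 * S n)%nat with (S (S (2 * n))) by lia.
  cbn [poch pow]; rewrite IH, S_INR, mult_INR; simpl (INR 2); field.
Qed.

Lemma poch_le (x y : R) (k : nat) : 0 < x <= y -> poch x k <= poch y k.
Proof.
  intros Hx; induction k as [|k IH]; simpl; [lra|].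
  pose proof (pos_INR k); apply Rmult_le_compat; try lra.
  apply Rlt_le, poch_pos; lra.
Qed.

Lemma INR_fact_S (k : nat) : INR (fact (S k)) = (INR k + 1) * INR (fact k).
Proof. rewrite fact_simpl, mult_INR, S_INR; reflexivity. Qed.

(** * Entire power series and hypergeometric coefficients *)

(** The ratio bound iterates to [|u k| <= |u 0| M^k / k!], so the exponential series is a majorant.
    The form without division admits vanishing coefficients. *)
Lemma ex_series_of_ratio (u : nat -> R) (M x : R) :
  0 <= M -> (forall k, (INR k + 1) * Rabs (u (S k)) <= M * Rabs (u k)) ->
  ex_series (fun k => Rabs (u k * x ^ k)).
Proof.
  intros HM Hu.
  assert (Hb : forall k, INR (fact k) * Rabs (u k) <= M ^ k * Rabs (u O)).
  { induction k as [|k IH]; [simpl; lra|].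
    rewrite INR_fact_S; simpl.
    apply Rle_trans with (M * (INR (fact k) * Rabs (u k))); [|nra].
    pose proof (INR_fact_lt_0 k); specialize (Hu k); nra. }
  apply (ex_series_le (K := R_AbsRing) (V := R_CompleteNormedModule))
    with (b := fun k => Rabs (u O) * (/ INR (fact k) * (M * Rabs x) ^ k)).
  - intros k; unfold norm; simpl; rewrite Rabs_Rabsolu, Rabs_mult, <- RPow_abs.
    rewrite Rpow_mult_distr.
    pose proof (INR_fact_lt_0 k); pose proof (pow_le _ k (Rabs_pos x)).
    assert (Rabs (u k) <= Rabs (u O) * / INR (fact k) * M ^ k).
    { apply Rmult_le_reg_l with (INR (fact k)); trivial.
      specialize (Hb k); field_simplify; [nra|lra]. }
    nra.
  - apply (ex_series_scal_l (K := R_AbsRing) (Rabs (u O))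
      (fun k => / INR (fact k) * (M * Rabs x) ^ k)).
    exists (exp (M * Rabs x)).
    generalize (is_exp_Reals (M * Rabs x)); apply is_series_ext.
    intros k; rewrite pow_n_pow; unfold scal; simpl; unfold mult; simpl; ring.
Qed.

Lemma CV_radius_of_ratio (u : nat -> R) (M : R) :
  0 <= M -> (forall k, (INR k + 1) * Rabs (u (S k)) <= M * Rabs (u k)) ->
  CV_radius u = p_infty.
Proof.
  intros HM Hu.
  destruct (Rbar_eq_dec (CV_radius u) p_infty) as [|Hr]; trivial; exfalso.
  assert (Hx : exists x, Rbar_lt (CV_radius u) (Rabs x)).
  { destruct (CV_radius u) as [r| |]; simpl; try easy; try (exists 0; easy).
    exists (Rabs r + 1).
    pose proof (Rle_abs r); pose proof (Rle_abs (Rabs r + 1)); lra. }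
  destruct Hx as [x Hx]; apply (CV_disk_outside _ _ Hx).
  apply ex_series_lim_0, ex_series_Rabs, (ex_series_of_ratio u M); trivial.
Qed.

(** Taylor coefficients in a variable [z], for which [- x ^ 2 / 4] is substituted later; in this way
    [coef01 b] belongs to the Bessel function of order [b - 1]. *)
Definition coef01 (b : R) (k : nat) : R := / (INR (fact k) * poch b k).
Definition coef12 (a b c : R) (k : nat) : R :=
  poch a k / (INR (fact k) * poch b k * poch c k).

Lemma coef01_pos (b : R) (k : nat) : 0 < b -> 0 < coef01 b k.
Proof.
  intros Hb; apply Rinv_0_lt_compat, Rmult_lt_0_compat;
    [apply INR_fact_lt_0|apply poch_pos, Hb].
Qed.

Lemma coef12_pos (a b c : R) (k : nat) :
  0 < a -> 0 < b -> 0 < c -> 0 < coef12 a b c k.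
Proof.
  intros Ha Hb Hc; apply Rdiv_lt_0_compat; [now apply poch_pos|].
  repeat apply Rmult_lt_0_compat;
    [apply INR_fact_lt_0|now apply poch_pos|now apply poch_pos].
Qed.

Lemma coef01_S (b : R) (k : nat) : 0 < b ->
  (INR k + 1) * (b + INR k) * coef01 b (S k) = coef01 b k.
Proof.
  intros Hb; unfold coef01; rewrite INR_fact_S; simpl.
  pose proof (pos_INR k); pose proof (INR_fact_lt_0 k).
  pose proof (poch_pos b k Hb); field; lra.
Qed.

Lemma coef12_S (a b c : R) (k : nat) : 0 < b -> 0 < c ->
  (INR k + 1) * (b + INR k) * (c + INR k) * coef12 a b c (S k) =
  (a + INR k) * coef12 a b c k.
Proof.
  intros Hb Hc; unfold coef12; rewrite INR_fact_S; simpl.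
  pose proof (pos_INR k); pose proof (INR_fact_lt_0 k).
  pose proof (poch_pos b k Hb); pose proof (poch_pos c k Hc); field; lra.
Qed.

Lemma CV_radius_coef01 (b : R) : 0 < b -> CV_radius (coef01 b) = p_infty.
Proof.
  intros Hb; apply (CV_radius_of_ratio _ (/ b)).
  { apply Rlt_le, Rinv_0_lt_compat, Hb. }
  intros k; pose proof (coef01_pos b k Hb); pose proof (coef01_pos b (S k) Hb).
  rewrite !Rabs_pos_eq by lra; rewrite <- (coef01_S b k Hb).
  pose proof (pos_INR k).
  apply Rmult_le_reg_l with b; trivial; field_simplify; try lra; nra.
Qed.

Lemma CV_radius_coef12 (a b c : R) : 0 < a -> 0 < b -> 0 < c ->
  CV_radius (coef12 a b c) = p_infty.
Proof.
  intros Ha Hb Hc.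
  assert (Hbc : 0 < b * c) by nra.
  (* The constant comes from [(a + t) b <= (a + b) (b + t)] and [c <= c + t], which bound
     [(a + t) / ((b + t) (c + t))]. *)
  apply (CV_radius_of_ratio _ ((a + b) / (b * c))).
  { apply Rlt_le, Rdiv_lt_0_compat; lra. }
  intros k; pose proof (coef12_pos a b c k Ha Hb Hc).
  pose proof (coef12_pos a b c (S k) Ha Hb Hc).
  rewrite !Rabs_pos_eq by lra.
  pose proof (coef12_S a b c k Hb Hc) as HS; pose proof (pos_INR k).
  set (u := coef12 a b c k) in *; set (v := coef12 a b c (S k)) in *.
  set (t := INR k) in *.
  apply Rmult_le_reg_l with ((a + t) * (b * c)); [nra|].
  replace ((a + t) * (b * c) * ((a + b) / (b * c) * u))
    with ((a + b) * ((a + t) * u)) by (field; lra).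
  rewrite <- HS.
  replace ((a + t) * (b * c) * ((t + 1) * v)) with
    ((t + 1) * v * ((a + t) * b * c)) by ring.
  replace ((a + b) * ((t + 1) * (b + t) * (c + t) * v)) with
    ((t + 1) * v * ((a + b) * (b + t) * (c + t))) by ring.
  apply Rmult_le_compat_l; [nra|].
  apply Rmult_le_compat; nra.
Qed.

Lemma BJ_PSeries (b x : R) : BJ (b - 1) x = PSeries (coef01 b) (- x ^ 2 / 4).
Proof.
  apply Series_ext; intros k; unfold coef01.
  replace (b - 1 + 1) with b by ring; unfold Rdiv; ring.
Qed.

Lemma F12_PSeries (a b c x : R) :
  F12 a b c x = PSeries (coef12 a b c) (- x ^ 2 / 4).
Proof. reflexivity. Qed.

(** Leibniz criterion: the terms tend to 0 because the series converges, and then the first two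
    partial sums bracket the limit. *)
Lemma alternating_bounds (u : nat -> R) (l : R) :
  Un_decreasing u -> is_series (fun k => (-1) ^ k * u k) l ->
  u 0%nat - u 1%nat <= l <= u 0%nat.
Proof.
  intros Hd Hs.
  assert (H0 : Un_cv u 0).
  { apply is_lim_seq_Reals, is_lim_seq_abs_0.
    assert (H := ex_series_lim_0 _ (ex_intro _ l Hs)).
    apply is_lim_seq_abs_0 in H; revert H; apply is_lim_seq_ext.
    intros k; rewrite Rabs_mult, pow_1_abs; ring. }
  assert (Hl : Un_cv (fun N => sum_f_R0 (tg_alt u) N) l).
  { apply is_lim_seq_Reals.
    apply is_lim_seq_ext with (sum_n (fun k => (-1) ^ k * u k)); [|exact Hs].
    intros n; rewrite sum_n_Reals; reflexivity. }
  pose proof (alternated_series_ineq u l 0 Hd H0 Hl) as H.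
  unfold tg_alt in H; simpl in H; lra.
Qed.

Lemma Rabs_lt_p_infty (u : nat -> R) (x : R) :
  CV_radius u = p_infty -> Rbar_lt (Rabs x) (CV_radius u).
Proof. intros ->; exact I. Qed.

Lemma ex_pseries_entire (u : nat -> R) (x : R) :
  CV_radius u = p_infty -> ex_series (fun k => u k * x ^ k).
Proof.
  intros Hu; apply ex_series_Rabs, CV_disk_inside.
  now apply Rabs_lt_p_infty.
Qed.

Lemma PSeries_correct_entire (u : nat -> R) (x : R) :
  CV_radius u = p_infty -> is_series (fun k => u k * x ^ k) (PSeries u x).
Proof. intros Hu; apply Series_correct, ex_pseries_entire, Hu. Qed.

Lemma neg_pow (y : R) (k : nat) : (- y) ^ k = (-1) ^ k * y ^ k.
Proof. rewrite <- Rpow_mult_distr; f_equal; ring. Qed.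

(** * Derivative, contiguity, sign and zeros of the normalized Bessel functions *)

Lemma coef01_derive (b : R) (k : nat) : 0 < b ->
  INR (S k) * coef01 b (S k) = / b * coef01 (b + 1) k.
Proof.
  intros Hb; unfold coef01; rewrite INR_fact_S, poch_S_l, S_INR.
  pose proof (pos_INR k); pose proof (INR_fact_lt_0 k).
  pose proof (poch_pos (b + 1) k ltac:(lra)); field; lra.
Qed.

Lemma PSeries_coef01_derive (b z : R) : 0 < b ->
  is_derive (PSeries (coef01 b)) z (/ b * PSeries (coef01 (b + 1)) z).
Proof.
  intros Hb.
  replace (/ b * PSeries (coef01 (b + 1)) z) with
    (PSeries (PS_derive (coef01 b)) z).
  { now apply is_derive_PSeries, Rabs_lt_p_infty, CV_radius_coef01. }
  rewrite <- PSeries_scal; apply PSeries_ext; intros k.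
  apply (coef01_derive b k Hb).
Qed.

(** Three-term recurrence of Bessel functions, checked on coefficients. Together with the derivative
    formula it stands in for the Bessel equation. *)
Lemma PSeries_coef01_contiguous (b z : R) : 0 < b ->
  z / (b * (b + 1)) * PSeries (coef01 (b + 2)) z =
  PSeries (coef01 b) z - PSeries (coef01 (b + 1)) z.
Proof.
  intros Hb.
  rewrite <- PSeries_minus by (apply CV_radius_inside, Rabs_lt_p_infty, CV_radius_coef01; lra).
  replace (z / (b * (b + 1)) * PSeries (coef01 (b + 2)) z) with
    (z * PSeries (PS_scal (/ (b * (b + 1))) (coef01 (b + 2))) z)
    by (rewrite PSeries_scal; unfold Rdiv; ring).
  rewrite <- PSeries_incr_1; apply PSeries_ext; intros [|k];
    unfold PS_incr_1, PS_minus, PS_plus, PS_opp, PS_scal, zero, plus, opp, scal;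
    simpl; unfold mult; simpl; unfold coef01; [simpl; field|].
  rewrite INR_fact_S, (poch_S_l b).
  pose proof (pos_INR k); pose proof (INR_fact_lt_0 k).
  pose proof (poch_pos (b + 2) k ltac:(lra)).
  pose proof (poch_pos (b + 1) k ltac:(lra)).
  assert (He : (b + 1) * poch (b + 2) k = poch (b + 1) k * (b + 1 + INR k)).
  { replace (b + 2) with (b + 1 + 1) by ring; rewrite <- poch_S_l; reflexivity. }
  replace (poch (b + 2) k) with (poch (b + 1) k * (b + 1 + INR k) / (b + 1))
    by (rewrite <- He; field; lra).
  simpl; field; lra.
Qed.

(** For [y < b] the moduli of the terms decrease, so Leibniz bounds the sum below by [1 - y / b]. *)
Lemma PSeries_coef01_pos (b y : R) : 0 < y < b ->
  0 < PSeries (coef01 b) (- y).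
Proof.
  intros Hy.
  assert (Hb : 0 < b) by lra.
  destruct (alternating_bounds (fun k => coef01 b k * y ^ k)
    (PSeries (coef01 b) (- y))) as [H _].
  - intros k; simpl.
    rewrite <- (coef01_S b k Hb).
    pose proof (coef01_pos b (S k) Hb); pose proof (pos_INR k).
    pose proof (pow_lt y k (proj1 Hy)).
    replace ((INR k + 1) * (b + INR k) * coef01 b (S k) * y ^ k) with
      (coef01 b (S k) * y ^ k * ((INR k + 1) * (b + INR k))) by ring.
    replace (coef01 b (S k) * (y * y ^ k)) with (coef01 b (S k) * y ^ k * y) by ring.
    apply Rmult_le_compat_l; [apply Rlt_le, Rmult_lt_0_compat; trivial|nra].
  - apply (is_series_ext (fun k => coef01 b k * (- y) ^ k)).
    + intros k; rewrite neg_pow; simpl; ring.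
    + apply PSeries_correct_entire, CV_radius_coef01, Hb.
  - unfold coef01 in H; simpl in H.
    assert (y / b < 1) by (apply Rlt_div_l; lra).
    replace (/ (1 * 1) * 1 - / (1 * (1 * (b + 0))) * (y * 1)) with (1 - y / b)
      in H by (field; lra).
    change (PSeries _ (- y)) with (PSeries (coef01 b) (- y)) in H; lra.
Qed.

(* With [w = z V'(z) / V(z)], the Bessel equation gives the Riccati equation
   [y dw/dy = - (w^2 + (b - 1) w + y)] at [z = - y]. Completing the square,
   [atan (w + (b - 1) / 2) + ln y] is nonincreasing for large [y], which is
   impossible since [atan] is bounded. *)
Lemma PSeries_coef01_zero (b : R) : 0 < b ->
  exists y, 0 < y /\ PSeries (coef01 b) (- y) = 0.
Proof.
  intros Hb.
  set (V := PSeries (coef01 b)).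
  destruct (Classical_Prop.classic (exists y, 0 < y /\ V (- y) = 0))
    as [|Hn]; trivial; exfalso.
  assert (HV : forall y, 0 < y -> V (- y) <> 0) by (intros y ? ?; apply Hn; eauto).
  set (V1 := PSeries (coef01 (b + 1))).
  set (V2 := PSeries (coef01 (b + 2))).
  set (s := fun y => - y * (/ b * V1 (- y)) / V (- y) + (b - 1) / 2).
  set (phi := fun y => atan (s y) + ln y).
  (* For [y >= Y] one has [y - (b - 1) ^ 2 / 4 >= 1], so the derivative of [atan (s y)] is at most
     [- 1 / y]. *)
  set (Y := (b - 1) ^ 2 / 4 + 1).
  assert (HY : 0 < Y) by (unfold Y; nra).
  set (dphi := fun y =>
    / (1 + (s y)²) * ((- (s y ^ 2) - y + (b - 1) ^ 2 / 4) / y) + / y).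
  assert (Hd : forall y, Y <= y -> is_derive phi y (dphi y)).
  { intros y Hy; unfold phi, dphi.
    apply (is_derive_plus (K := R_AbsRing) (V := R_NormedModule));
      [|apply is_derive_ln; lra].
    rewrite Rmult_comm.
    apply (is_derive_comp (K := R_AbsRing) (V := R_NormedModule) atan s);
      [apply is_derive_atan|].
    assert (H0 : is_derive (fun y => V (- y)) y (- (/ b * V1 (- y)))).
    { replace (- (/ b * V1 (- y))) with (-1 * (/ b * V1 (- y))) by ring.
      apply (is_derive_comp (K := R_AbsRing) (V := R_NormedModule) V Ropp).
      - apply PSeries_coef01_derive, Hb.
      - auto_derive; trivial. }
    assert (H1 : is_derive (fun y => V1 (- y)) y (- (/ (b + 1) * V2 (- y)))).
    { replace (- (/ (b + 1) * V2 (- y))) with (-1 * (/ (b + 1) * V2 (- y))) by ring.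
      apply (is_derive_comp (K := R_AbsRing) (V := R_NormedModule) V1 Ropp).
      - unfold V2; replace (b + 2) with (b + 1 + 1) by ring.
        apply PSeries_coef01_derive; lra.
      - auto_derive; trivial. }
    unfold s.
    set (f0 := fun y => V (- y)) in *; set (f1 := fun y => V1 (- y)) in *.
    assert (Hf : f0 y <> 0) by (apply HV; lra).
    apply (is_derive_ext (fun y => - y * (/ b * f1 y) / f0 y + (b - 1) / 2));
      [reflexivity|].
    assert (Hc := PSeries_coef01_contiguous b (- y) Hb).
    fold V V1 V2 in Hc; fold (f0 y) (f1 y) in Hc.
    replace (V2 (- y)) with (- (b * (b + 1)) / y * (f0 y - f1 y)) in H1
      by (rewrite <- Hc; field; lra).
    auto_derive.
    - repeat split; trivial; eexists; eassumption.
    - change (fun x => f0 x) with f0; change (fun x => f1 x) with f1.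
      rewrite (is_derive_unique f0 y _ H0), (is_derive_unique f1 y _ H1).
      fold (f1 y) (f0 y). field; lra. }
  assert (Hneg : forall y, Y <= y -> dphi y <= 0).
  { intros y Hy; unfold dphi, Rsqr.
    assert (0 < 1 + s y * s y) by nra.
    replace (/ (1 + s y * s y) * ((- s y ^ 2 - y + (b - 1) ^ 2 / 4) / y) + / y)
      with ((Y - y) / ((1 + s y * s y) * y)) by (unfold Y; field; lra).
    unfold Rdiv; apply Rmult_le_reg_r with ((1 + s y * s y) * y).
    - apply Rmult_lt_0_compat; lra.
    - rewrite Rmult_assoc, Rinv_l; [lra|].
      apply Rgt_not_eq, Rmult_lt_0_compat; lra. }
  (* Here [ln y > phi Y + PI], so that [phi y <= phi Y] forces [atan (s y) < - PI]. *)
  set (y := Y + exp (phi Y + PI)).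
  assert (Hy : Y < y) by (unfold y; pose proof (exp_pos (phi Y + PI)); lra).
  destruct (MVT_gen phi Y y dphi) as [c [Hc1 Hc2]].
  - rewrite Rmin_left, Rmax_right by lra; intros; apply Hd; lra.
  - rewrite Rmin_left, Rmax_right by lra; intros.
    apply derivable_continuous_pt; exists (dphi x).
    apply is_derive_Reals, Hd; lra.
  - rewrite Rmin_left, Rmax_right in Hc1 by lra.
    specialize (Hneg c ltac:(lra)).
    assert (phi y <= phi Y) by nra.
    assert (phi Y + PI < ln y).
    { rewrite <- (ln_exp (phi Y + PI)); apply ln_increasing;
        [apply exp_pos|unfold y; lra]. }
    pose proof (atan_bound (s y)).
    unfold phi at 1 in H; lra.
Qed.

(** * Positivity under raising of the lower parameters, and the range [b <= 1 / 2] *)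

(** The derivative formula for [y^b F(a; b+1, c; -y)] freed of the power of [y]; on coefficients it
    is [(b + k) / (b+1)_k = b / (b)_k]. *)
Lemma PSeries_coef12_step (a b c z : R) : 0 < a -> 0 < b -> 0 < c ->
  z * PSeries (PS_derive (coef12 a (b + 1) c)) z +
  b * PSeries (coef12 a (b + 1) c) z = b * PSeries (coef12 a b c) z.
Proof.
  intros Ha Hb Hc.
  assert (Hr : CV_radius (coef12 a (b + 1) c) = p_infty)
    by (apply CV_radius_coef12; lra).
  rewrite <- PSeries_incr_1, <- !PSeries_scal, <- PSeries_plus.
  - apply PSeries_ext; intros [|k];
    unfold PS_incr_1, PS_plus, PS_scal, PS_derive, zero, plus, scal;
    simpl; unfold mult; simpl; unfold coef12; [simpl; field; lra|].
    change (match k with O => 1 | S _ => INR k + 1 end) with (INR (S k)).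
    rewrite (poch_S_l b), S_INR, INR_fact_S.
    pose proof (pos_INR k); pose proof (INR_fact_lt_0 k).
    pose proof (poch_pos (b + 1) k ltac:(lra)).
    pose proof (poch_pos c k Hc).
    simpl; field; lra.
  - apply CV_radius_inside; rewrite CV_radius_incr_1, CV_radius_derive.
    now apply Rabs_lt_p_infty.
  - apply ex_pseries_scal; [apply Rmult_comm|].
    now apply CV_radius_inside, Rabs_lt_p_infty.
Qed.

(** By the previous identity [psi y = y^b g (- y)] is strictly increasing. If [g] were nonpositive
    at one point, it would be negative at all points between that one and 0, against continuity and
    [g 0 = 1]. *)
Lemma P12_step (a b c : R) : P12 a b c -> P12 a (b + 1) c.
Proof.
  intros (Ha & Hb & Hc & HF); repeat split; try lra.
  intros x Hx; rewrite F12_PSeries.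
  set (f := PSeries (coef12 a b c)); set (g := PSeries (coef12 a (b + 1) c)).
  set (dg := PSeries (PS_derive (coef12 a (b + 1) c))).
  assert (Hr : CV_radius (coef12 a (b + 1) c) = p_infty)
    by (apply CV_radius_coef12; lra).
  (* The value [x = 2 sqrt y] turns [- x ^ 2 / 4] into [- y]. *)
  assert (Hf : forall y, 0 < y -> 0 < f (- y)).
  { intros y Hy; pose proof (sqrt_lt_R0 y Hy).
    specialize (HF (2 * sqrt y) ltac:(lra)); rewrite F12_PSeries in HF.
    replace (- (2 * sqrt y) ^ 2 / 4) with (- y) in HF; trivial.
    rewrite Rpow_mult_distr, pow2_sqrt by lra; field. }
  set (psi := fun y => Rpower y b * g (- y)).
  set (dpsi := fun y => Rpower y b * (b * f (- y) / y)).
  assert (Hd : forall y, 0 < y -> is_derive psi y (dpsi y)).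
  { intros y Hy.
    assert (Hg : is_derive (fun y => g (- y)) y (- dg (- y))).
    { replace (- dg (- y)) with (-1 * dg (- y)) by ring.
      apply (is_derive_comp (K := R_AbsRing) (V := R_NormedModule) g Ropp).
      - now apply is_derive_PSeries, Rabs_lt_p_infty.
      - auto_derive; trivial. }
    assert (He := PSeries_coef12_step a b c (- y) Ha Hb Hc).
    fold f g dg in He; unfold psi, dpsi.
    rewrite <- He.
    replace (Rpower y b * ((- y * dg (- y) + b * g (- y)) / y)) with
      (b * / y * exp (b * ln y) * g (- y) + Rpower y b * - dg (- y))
      by (unfold Rpower; field; lra).
    apply (is_derive_mult (fun y => Rpower y b) (fun y => g (- y)));
      [|exact Hg|apply Rmult_comm].
    unfold Rpower; auto_derive; [lra|ring]. }
  assert (Hlt : forall y1 y2, 0 < y1 < y2 -> psi y1 < psi y2).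
  { intros y1 y2 Hy; destruct (MVT_gen psi y1 y2 dpsi) as [t [Ht1 Ht2]].
    - rewrite Rmin_left, Rmax_right by lra; intros; apply Hd; lra.
    - rewrite Rmin_left, Rmax_right by lra; intros.
      apply derivable_continuous_pt; exists (dpsi x0).
      apply is_derive_Reals, Hd; lra.
    - rewrite Rmin_left, Rmax_right in Ht1 by lra.
      assert (0 < dpsi t).
      { unfold dpsi; apply Rmult_lt_0_compat; [apply exp_pos|].
        specialize (Hf t ltac:(lra)); apply Rdiv_lt_0_compat; nra. }
      nra. }
  replace (- x ^ 2 / 4) with (- (x ^ 2 / 4)) by field.
  assert (Hx2 : 0 < x ^ 2 / 4) by nra.
  destruct (Rlt_or_le 0 (g (- (x ^ 2 / 4)))) as [|Hle]; trivial; exfalso.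
  assert (Hneg : forall y, 0 < y < x ^ 2 / 4 -> g (- y) < 0).
  { intros y Hy; specialize (Hlt _ _ Hy); unfold psi in Hlt.
    pose proof (exp_pos (b * ln y)); pose proof (exp_pos (b * ln (x ^ 2 / 4))).
    unfold Rpower in Hlt; nra. }
  assert (Hg0 : continuity_pt g 0)
    by (now apply PSeries_continuity, Rabs_lt_p_infty).
  assert (Hg1 : g 0 = 1).
  { unfold g; rewrite PSeries_0; unfold coef12; simpl; field. }
  destruct (Hg0 1 ltac:(lra)) as [d [Hd0 Hd1]].
  set (y := Rmin d (x ^ 2 / 4) / 2).
  assert (Hy : 0 < y < d /\ y < x ^ 2 / 4).
  { unfold y; pose proof (Rmin_l d (x ^ 2 / 4)).
    pose proof (Rmin_r d (x ^ 2 / 4)).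
    pose proof (Rmin_glb_lt d (x ^ 2 / 4) 0); lra. }
  specialize (Hneg y ltac:(lra)).
  specialize (Hd1 (- y)); unfold dist in Hd1; simpl in Hd1; unfold Rdist in Hd1.
  rewrite Hg1, (Rabs_left (g (- y) - 1)) in Hd1 by lra.
  assert (- (g (- y) - 1) < 1); [apply Hd1|lra].
  split; [split; [exact I|lra]|].
  replace (- y - 0) with (- y) by ring; rewrite Rabs_left; lra.
Qed.

(** Lets [P12_step] act on the other lower parameter as well. *)
Lemma P12_sym (a b c : R) : P12 a b c -> P12 a c b.
Proof.
  intros (Ha & Hb & Hc & HF); repeat split; trivial.
  intros x Hx; replace (F12 a c b x) with (F12 a b c x); [now apply HF|].
  apply PSeries_ext; intros k; unfold Rdiv; f_equal; f_equal; ring.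
Qed.

(* The series is dominated by its first three terms at the minimum point
   [y = (b + 1) (c + 1) / (a + 1)] of that quadratic, where they add up to
   [1 - a y / (2 b c) < 0]. *)
Lemma P12_small (a b : R) : b <= 1 / 2 -> ~ P12 a b (a + b - 1 / 2).
Proof.
  intros Hb2 (Ha & Hb & Hc & HF).
  set (c := a + b - 1 / 2) in *.
  set (y := (b + 1) * (c + 1) / (a + 1)).
  assert (Hy : 0 < y) by (apply Rdiv_lt_0_compat; nra).
  assert (Hy2 : y <= 3 / 2).
  { apply Rle_div_l; [lra|].
    assert (c <= a) by (unfold c; lra); nra. }
  pose proof (sqrt_lt_R0 y Hy).
  specialize (HF (2 * sqrt y) ltac:(lra)); rewrite F12_PSeries in HF.
  replace (- (2 * sqrt y) ^ 2 / 4) with (- y) in HF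
    by (rewrite Rpow_mult_distr, pow2_sqrt by lra; field).
  assert (Hs := PSeries_correct_entire (coef12 a b c) (- y)
    (CV_radius_coef12 _ _ _ Ha Hb Hc)).
  (* The constant and linear terms are split off; the alternating tail is at most its leading term,
     the quadratic one. *)
  unfold PSeries in HF; rewrite (Series_incr_n _ 2) in HF by (lia || now eexists; apply Hs).
  destruct (alternating_bounds (fun k => coef12 a b c (2 + k) * y ^ (2 + k))
    (Series (fun k => coef12 a b c (2 + k) * (- y) ^ (2 + k)))) as [_ H1].
  - intros k.
    pose proof (coef12_S a b c (2 + k) Hb Hc) as HS.
    pose proof (coef12_pos a b c (2 + k) Ha Hb Hc) as H2.
    pose proof (coef12_pos a b c (S (2 + k)) Ha Hb Hc) as H3.
    replace (2 + S k)%nat with (S (2 + k)) by lia.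
    set (u := coef12 a b c (2 + k)) in *; set (v := coef12 a b c (S (2 + k))) in *.
    replace (y ^ S (2 + k)) with (y * y ^ (2 + k)) by reflexivity.
    pose proof (pow_lt y (2 + k) Hy).
    set (t := INR (2 + k)) in *.
    assert (Ht : 2 <= t) by (unfold t; rewrite plus_INR; simpl; pose proof (pos_INR k); lra).
    rewrite <- Rmult_assoc; apply Rmult_le_compat_r; [lra|].
    apply Rmult_le_reg_l with (a + t); [lra|].
    rewrite <- HS.
    (* The factor [5 / 4] comes from [a < c + 1 / 2] and [c + t >= 2]. *)
    assert (a + t <= 5 / 4 * (c + t)) by (unfold c in *; lra).
    assert ((a + t) * y <= 5 / 4 * (c + t) * (3 / 2)) by (apply Rmult_le_compat; lra).
    assert (5 / 4 * (3 / 2) <= (t + 1) * (b + t)) by nra.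
    replace ((a + t) * (v * y)) with ((a + t) * y * v) by ring.
    apply Rmult_le_compat_r; [lra|]; nra.
  - apply (is_series_ext (fun k => coef12 a b c (2 + k) * (- y) ^ (2 + k))).
    + intros k; rewrite (neg_pow y (2 + k)), (pow_add (-1)); simpl; ring.
    + apply Series_correct.
      apply (ex_series_incr_n (fun k => coef12 a b c k * (- y) ^ k) 2).
      eexists; apply Hs.
  - assert (H2 : (coef12 a b c 0 * (- y) ^ 0 + coef12 a b c 1 * (- y) ^ 1)
      + coef12 a b c 2 * y ^ 2 = 1 - a * y / (2 * b * c)).
    { unfold coef12, y; simpl; field; lra. }
    (* This is the chain [2 b c (a + 1) <= c (a + 1) <= a (c + 1) < a (b + 1) (c + 1)], from
       [2 b <= 1] and [c <= a]. *)
    assert (H3 : 1 < a * y / (2 * b * c)).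
    { assert (c <= a) by (unfold c; lra).
      assert (Hbc : 0 < 2 * b * c) by nra.
      apply (Rlt_div_r 1 _ _ Hbc); rewrite Rmult_1_l; unfold y.
      replace (a * ((b + 1) * (c + 1) / (a + 1))) with
        (a * (b + 1) * (c + 1) / (a + 1)) by (field; lra).
      apply (Rlt_div_r (2 * b * c) _ (a + 1) ltac:(lra)).
      assert (2 * b * c <= c) by nra.
      assert (2 * b * c * (a + 1) <= c * (a + 1)) by (apply Rmult_le_compat_r; lra).
      assert (c * (a + 1) <= a * (c + 1)) by nra.
      assert (0 < a * (c + 1)) by nra.
      replace (a * (b + 1) * (c + 1)) with (a * (c + 1) + b * (a * (c + 1))) by ring.
      assert (0 < b * (a * (c + 1))) by (apply Rmult_lt_0_compat; lra).
      lra. }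
    set (T := Series (fun k => coef12 a b c (2 + k) * (- y) ^ (2 + k))) in *.
    change (coef12 a b c 2 * y ^ 2) with
      (coef12 a b c (2 + 0) * y ^ (2 + 0)) in H2.
    simpl sum_f_R0 in HF; simpl pow in *; simpl Nat.add in *; lra.
Qed.

(** * Rearrangement of double series *)

(** Both sides run over [n + m <= K], by antidiagonals and by rows. *)
Lemma sum_triangle (h : nat -> nat -> R) (K : nat) :
  sum_f_R0 (fun k => sum_f_R0 (fun n => h n (k - n)%nat) k) K =
  sum_f_R0 (fun n => sum_f_R0 (h n) (K - n)) K.
Proof.
  induction K as [|K IH]; [reflexivity|].
  rewrite (tech5 _ K), IH, (tech5 (fun n => h n _) K), (tech5 _ K), Nat.sub_diag.
  rewrite <- Rplus_assoc; f_equal; rewrite <- sum_plus.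
  apply sum_eq; intros n Hn.
  replace (S K - n)%nat with (S (K - n)) by lia; reflexivity.
Qed.

Lemma Series_tail_le (u q : nat -> R) (c : R) (M : nat) :
  (forall m, Rabs (u m) <= c * q m) -> ex_series q ->
  Rabs (Series u - sum_f_R0 u M) <= c * (Series q - sum_f_R0 q M).
Proof.
  intros Hu Hq.
  assert (Hcq : ex_series (fun m => c * q m))
    by apply (ex_series_scal_l (K := R_AbsRing) c q Hq).
  assert (Hau : ex_series (fun m => Rabs (u m))).
  { apply (ex_series_le (K := R_AbsRing) (V := R_CompleteNormedModule))
      with (b := fun m => c * q m); trivial.
    intros m; unfold norm; simpl; rewrite Rabs_Rabsolu; apply Hu. }
  rewrite (Series_incr_n u (S M)), (Series_incr_n q (S M))
    by (trivial; lia || now apply ex_series_Rabs); simpl Init.Nat.pred.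
  replace (sum_f_R0 u M + Series (fun k => u (S M + k)%nat) - sum_f_R0 u M)
    with (Series (fun k => u (S M + k)%nat)) by ring.
  replace (sum_f_R0 q M + Series (fun k => q (S M + k)%nat) - sum_f_R0 q M)
    with (Series (fun k => q (S M + k)%nat)) by ring.
  apply (ex_series_incr_n (fun m => Rabs (u m)) (S M)) in Hau.
  apply (ex_series_incr_n (fun m => c * q m) (S M)) in Hcq.
  eapply Rle_trans; [apply Series_Rabs, Hau|].
  rewrite <- Series_scal_l; apply Series_le; trivial.
  intros m; split; [apply Rabs_pos|apply Hu].
Qed.

(** The sum [A K] of the first full rows differs from the triangle [T K] by row tails. Their
    majorant is [(p 0 + ... + p K) * Series q] minus the triangle of [p n * q m], and it tends to 0
    by the Cauchy product theorem. *)
Lemma is_series_triangle (G : nat -> nat -> R) (p q : nat -> R) (l : R) :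
  (forall n, 0 <= p n) -> (forall m, 0 <= q m) ->
  (forall n m, Rabs (G n m) <= p n * q m) -> ex_series p -> ex_series q ->
  is_series (fun k => sum_f_R0 (fun n => G n (k - n)%nat) k) l ->
  is_series (fun n => Series (G n)) l.
Proof.
  intros Hp Hq HG Ep Eq Hl.
  set (A := fun K => sum_f_R0 (fun n => Series (G n)) K).
  set (T := fun K => sum_f_R0 (fun k => sum_f_R0 (fun n => G n (k - n)%nat) k) K).
  set (pq := fun k => sum_f_R0 (fun n => p n * q (k - n)%nat) k).
  assert (Hb : forall K, Rabs (A K - T K) <=
    sum_f_R0 p K * Series q - sum_f_R0 pq K).
  { intros K; unfold A, T, pq.
    rewrite (sum_triangle G), (sum_triangle (fun n m => p n * q m)), <- minus_sum.
    eapply Rle_trans; [apply (Rsum_abs _ K)|].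
    rewrite (Rmult_comm _ (Series q)), scal_sum, <- minus_sum.
    apply sum_Rle; intros n _.
    eapply Rle_trans; [apply (Series_tail_le _ q (p n)); trivial|].
    rewrite (sum_eq (fun m => p n * q m) (fun m => q m * p n)), <- scal_sum
      by (intros; ring).
    lra. }
  assert (Hsum : forall u s, is_series u s -> is_lim_seq (sum_f_R0 u) s).
  { intros u s Hs; apply is_lim_seq_ext with (sum_n u); [|exact Hs].
    intros n; apply sum_n_Reals. }
  assert (Hz : is_lim_seq (fun K => A K - T K) 0).
  { apply is_lim_seq_abs_0.
    apply is_lim_seq_le_le with (fun _ => 0)
      (fun K => sum_f_R0 p K * Series q - sum_f_R0 pq K).
    - intros K; split; [apply Rabs_pos|apply Hb].
    - apply is_lim_seq_const.
    - replace (Finite 0) with (Finite (Series p * Series q - Series p * Series q))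
        by (f_equal; ring).
      apply is_lim_seq_minus'.
      + apply (is_lim_seq_scal_r (sum_f_R0 p) (Series q) (Series p)).
        apply Hsum, Series_correct, Ep.
      + apply Hsum, is_series_mult; try now apply Series_correct.
        * apply (ex_series_ext p); trivial.
          intros n; rewrite Rabs_pos_eq; trivial.
        * apply (ex_series_ext q); trivial.
          intros n; rewrite Rabs_pos_eq; trivial. }
  change (is_lim_seq (sum_n (fun n => Series (G n))) l).
  apply is_lim_seq_ext with (fun K => (A K - T K) + T K).
  { intros K; rewrite sum_n_Reals; unfold A; ring. }
  replace (Finite l) with (Finite (0 + l)) by (f_equal; ring).
  apply is_lim_seq_plus'; [exact Hz|apply Hsum, Hl].
Qed.

(** * Squares of Bessel functions *)

(* Chu-Vandermonde, by induction on [k] through [k = i + (k - i)]. *)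
Lemma coef01_convolution (k : nat) : forall b c : R, 0 < b -> 0 < c ->
  PS_mult (coef01 b) (coef01 c) k =
  poch (b + c + INR k - 1) k / (INR (fact k) * poch b k * poch c k).
Proof.
  unfold PS_mult.
  induction k as [|k IH]; intros b c Hb Hc; [unfold coef01; simpl; field|].
  assert (Hk : INR (S k) <> 0) by (apply not_0_INR; lia).
  apply Rmult_eq_reg_l with (INR (S k)); trivial.
  transitivity (/ b * sum_f_R0 (fun i => coef01 (b + 1) i * coef01 c (k - i)) k
    + / c * sum_f_R0 (fun i => coef01 b i * coef01 (c + 1) (k - i)) k).
  - transitivity
      (sum_f_R0 (fun i => INR i * coef01 b i * coef01 c (S k - i)) (S k) +
       sum_f_R0 (fun i => coef01 b i * (INR (S k - i) * coef01 c (S k - i))) (S k)).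
    + rewrite <- sum_plus, scal_sum; apply sum_eq; intros i Hi.
      rewrite (minus_INR _ _ Hi); ring.
    + f_equal.
      * rewrite decomp_sum by lia; simpl Init.Nat.pred; rewrite scal_sum.
        simpl (INR 0); rewrite 2!Rmult_0_l, Rplus_0_l.
        apply sum_eq; intros i Hi; rewrite coef01_derive by trivial.
        replace (S k - S i)%nat with (k - i)%nat by lia; ring.
      * rewrite tech5, Nat.sub_diag; simpl (INR 0).
        rewrite Rmult_0_l, Rmult_0_r, Rplus_0_r, scal_sum.
        apply sum_eq; intros i Hi.
        replace (S k - i)%nat with (S (k - i)) by lia.
        rewrite coef01_derive by trivial; ring.
  - rewrite !IH by lra.
    replace (b + 1 + c + INR k - 1) with (b + c + INR k) by ring.
    replace (b + (c + 1) + INR k - 1) with (b + c + INR k) by ring.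
    replace (b + c + INR (S k) - 1) with (b + c + INR k) by (rewrite S_INR; ring).
    assert (Hp : forall x, 0 < x -> poch (x + 1) k = poch x k * (x + INR k) / x).
    { intros x Hx; change (poch x k * (x + INR k)) with (poch x (S k)).
      rewrite poch_S_l; field; lra. }
    rewrite !Hp, INR_fact_S, S_INR by trivial; simpl.
    pose proof (pos_INR k); pose proof (INR_fact_lt_0 k).
    pose proof (poch_pos b k Hb); pose proof (poch_pos c k Hc); field; lra.
Qed.

(** Chu-Vandermonde produces [(2 beta + k)_k = (2 beta)_(2k) / (2 beta)_k], which the duplication
    formula splits; its [4 ^ k] moves into the argument. *)
Lemma PSeries_coef01_sqr (beta w : R) : 0 < beta ->
  PSeries (coef01 (beta + 1 / 2)) w ^ 2 =
  PSeries (coef12 beta (beta + 1 / 2) (2 * beta)) (4 * w).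
Proof.
  intros Hb; simpl; rewrite Rmult_1_r, <- PSeries_mult
    by (apply Rabs_lt_p_infty, CV_radius_coef01; lra).
  apply Series_ext; intros k; rewrite Rpow_mult_distr, <- Rmult_assoc; f_equal.
  rewrite coef01_convolution by lra; unfold coef12.
  replace (beta + 1 / 2 + (beta + 1 / 2) + INR k - 1) with (2 * beta + INR k)
    by field.
  assert (H := poch_double beta k).
  replace (2 * k)%nat with (k + k)%nat in H by lia; rewrite poch_add in H.
  pose proof (poch_pos (2 * beta) k ltac:(lra)).
  pose proof (poch_pos (beta + 1 / 2) k ltac:(lra)).
  pose proof (INR_fact_lt_0 k).
  replace (poch (2 * beta + INR k) k) with
    (4 ^ k * poch beta k * poch (beta + 1 / 2) k / poch (2 * beta) k)
    by (rewrite <- H; field; lra).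
  field; lra.
Qed.

(** * The coefficient identity behind Gasper's expansion *)

(* This is [A_n = (2 n + 2 beta - 1) / (n + 2 beta - 1) * (2 beta)_n / n!], in a
   form that makes sense also for [n = 0], [2 beta = 1]. *)
Definition weight (beta : R) (n : nat) : R :=
  poch (2 * beta) n / INR (fact n) +
  match n with O => 0 | S m => poch (2 * beta) m / INR (fact m) end.

(* The very-well-poised summand that remains when the coefficients of [z^k] in
   the expansion are divided by [(beta)_k / (b)_k]. *)
Definition wp_term (a beta : R) (k n : nat) : R :=
  (-1) ^ n * weight beta n * poch (beta - a) n /
  (poch (a + beta) n * INR (fact (k - n)) * poch (2 * beta) (k + n)).

(* Zeilberger's recurrence in [k] for the sum of [wp_term a beta k], with its
   certificate summed up. *)
Lemma wp_term_telescope (a beta : R) (k N : nat) :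
  0 < a -> 0 < beta -> (N <= k)%nat ->
  sum_f_R0 (fun n =>
    (INR k + 1) * (a + beta + INR k) * (beta + INR k) * wp_term a beta (S k) n
    - (a + INR k) * wp_term a beta k n) N =
  (beta + INR N) * (-1) ^ N * (poch (2 * beta) N / INR (fact N)) *
  poch (beta - a) (S N) /
  (poch (a + beta) N * INR (fact (k - N)) * poch (2 * beta) (S (k + N))).
Proof.
  intros Ha Hb; induction N as [|N IH]; intros HN.
  - simpl sum_f_R0; unfold wp_term, weight.
    rewrite !Nat.sub_0_r, !Nat.add_0_r, INR_fact_S; simpl poch.
    simpl fact; simpl INR; simpl pow.
    pose proof (pos_INR k); pose proof (INR_fact_lt_0 k).
    pose proof (poch_pos (2 * beta) k ltac:(lra)); field; lra.
  - rewrite tech5, IH by lia; unfold wp_term, weight.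
    remember (k - S N)%nat as j eqn:Ej.
    replace (k - N)%nat with (S j) by lia.
    replace (S k - S N)%nat with (S j) by lia.
    replace (S k + S N)%nat with (S (S (k + N))) by lia.
    replace (k + S N)%nat with (S (k + N)) by lia.
    assert (Hk : INR k = INR j + INR N + 1)
      by (replace k with (j + S N)%nat by lia; rewrite plus_INR, S_INR; ring).
    rewrite !INR_fact_S; cbn [poch pow]; rewrite !S_INR, plus_INR, Hk.
    pose proof (pos_INR N); pose proof (pos_INR j).
    pose proof (INR_fact_lt_0 N); pose proof (INR_fact_lt_0 j).
    pose proof (poch_pos (2 * beta) N ltac:(lra)).
    pose proof (poch_pos (a + beta) N ltac:(lra)).
    pose proof (poch_pos (2 * beta) (k + N) ltac:(lra)).
    field; lra.
Qed.

(** Both sides obey the same first-order recurrence in [k]. Telescoping covers [n <= k] only; the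
    extra term [n = k + 1] of the new row cancels the boundary term. The result is a terminating
    very-well-poised 5F4 sum at 1 in which a parameter pair [beta], [beta] cancels. *)
Lemma wp_term_sum (a beta : R) (k : nat) : 0 < a -> 0 < beta ->
  sum_f_R0 (wp_term a beta k) k =
  poch a k / (INR (fact k) * poch (a + beta) k * poch beta k).
Proof.
  intros Ha Hb; induction k as [|k IH]; [unfold wp_term, weight; simpl; field|].
  pose proof (pos_INR k); pose proof (INR_fact_lt_0 k).
  pose proof (poch_pos (a + beta) k ltac:(lra)); pose proof (poch_pos beta k Hb).
  set (lam := (INR k + 1) * (a + beta + INR k) * (beta + INR k)).
  assert (Hl : lam <> 0)
    by (unfold lam; apply Rgt_not_eq; repeat apply Rmult_lt_0_compat; lra).
  apply Rmult_eq_reg_l with lam; trivial.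
  assert (Ht := wp_term_telescope a beta k k Ha Hb (le_n k)); fold lam in Ht.
  rewrite minus_sum in Ht.
  rewrite (sum_eq _ (fun n => wp_term a beta (S k) n * lam)), <- scal_sum in Ht
    by (intros; ring).
  rewrite (sum_eq (fun n => (a + INR k) * _)
    (fun n => wp_term a beta k n * (a + INR k))), <- scal_sum, IH in Ht
    by (intros; ring).
  rewrite tech5, Rmult_plus_distr_l.
  match type of Ht with ?x - ?y = ?z => replace x with (y + z) by lra end.
  unfold wp_term, weight; rewrite Nat.sub_diag.
  replace (S k - S k)%nat with 0%nat by lia.
  replace (S k + S k)%nat with (S (S (k + k))) by lia.
  unfold lam; rewrite !INR_fact_S; cbn [poch pow]; rewrite !S_INR, plus_INR.
  simpl fact; simpl INR.
  pose proof (poch_pos (2 * beta) k ltac:(lra)).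
  pose proof (poch_pos (2 * beta) (k + k) ltac:(lra)).
  field; lra.
Qed.

Definition sqr_coef (a beta : R) (n : nat) : R :=
  weight beta n * poch (beta - a) n /
  (poch (a + beta) n * poch (beta + 1 / 2) n ^ 2).

(** Coefficient of [z^k] in Gasper's expansion, each squared Bessel function being written as a 1F2.
    Splitting the rising factorials at [n] extracts [(beta)_k / (beta + 1/2)_k] and leaves
    [wp_term]. *)
Lemma coef12_expansion (a beta : R) (k : nat) : 0 < a -> 0 < beta ->
  sum_f_R0 (fun n => sqr_coef a beta n * (- / 4) ^ n *
    coef12 (beta + INR n) (beta + 1 / 2 + INR n) (2 * beta + INR (2 * n))
      (k - n)) k =
  coef12 a (beta + 1 / 2) (a + beta) k.
Proof.
  intros Ha Hb.
  pose proof (poch_pos beta k Hb); pose proof (poch_pos (beta + 1 / 2) k ltac:(lra)).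
  transitivity (poch beta k / poch (beta + 1 / 2) k * sum_f_R0 (wp_term a beta k) k).
  - rewrite scal_sum; apply sum_eq; intros n Hn.
    unfold sqr_coef, wp_term, coef12.
    remember (k - n)%nat as m eqn:Em.
    replace (k + n)%nat with (2 * n + m)%nat by lia.
    replace k with (n + m)%nat in * by lia.
    rewrite (poch_add beta n m), (poch_add (beta + 1 / 2) n m) in *.
    rewrite (poch_add (2 * beta)), poch_double.
    replace ((- / 4) ^ n) with ((-1) ^ n / 4 ^ n).
    2: { unfold Rdiv; rewrite <- pow_inv, <- Rpow_mult_distr; f_equal; lra. }
    pose proof (poch_pos beta n Hb); pose proof (poch_pos (beta + 1 / 2) n ltac:(lra)).
    pose proof (poch_pos (a + beta) n ltac:(lra)); pose proof (pos_INR n).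
    pose proof (poch_pos (beta + INR n) m ltac:(lra)).
    pose proof (poch_pos (beta + 1 / 2 + INR n) m ltac:(lra)).
    pose proof (pos_INR (2 * n)).
    pose proof (poch_pos (2 * beta + INR (2 * n)) m ltac:(lra)).
    pose proof (INR_fact_lt_0 m); pose proof (pow_lt 4 n ltac:(lra)).
    field; lra.
  - rewrite wp_term_sum by trivial; unfold coef12.
    pose proof (poch_pos (a + beta) k ltac:(lra)).
    pose proof (INR_fact_lt_0 k); field; lra.
Qed.

(** * Convergence of Gasper's expansion *)

(** Each factor [(2 beta + j) / (j + 1)] is at most [1 + 2 beta]; the leading 2 accounts for the two
    summands of [weight]. *)
Lemma weight_bounds (beta : R) (n : nat) : 0 < beta ->
  0 < weight beta n <= 2 * (1 + 2 * beta) ^ n.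
Proof.
  intros Hb.
  assert (HC : forall j,
    0 < poch (2 * beta) j / INR (fact j) <= (1 + 2 * beta) ^ j).
  { intros j; split.
    - apply Rdiv_lt_0_compat; [apply poch_pos; lra|apply INR_fact_lt_0].
    - apply Rle_div_l; [apply INR_fact_lt_0|].
      induction j as [|j IH]; [simpl; lra|].
      rewrite INR_fact_S; cbn [poch pow].
      pose proof (poch_pos (2 * beta) j ltac:(lra)); pose proof (pos_INR j).
      apply Rle_trans with
        ((1 + 2 * beta) ^ j * INR (fact j) * (2 * beta + INR j)).
      + apply Rmult_le_compat_r; lra.
      + replace ((1 + 2 * beta) * (1 + 2 * beta) ^ j * ((INR j + 1) * INR (fact j)))
          with ((1 + 2 * beta) ^ j * INR (fact j) * ((1 + 2 * beta) * (INR j + 1)))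
          by ring.
        apply Rmult_le_compat_l; [lra|nra]. }
  unfold weight; specialize (HC n) as Hn; destruct n as [|n].
  - simpl in *; lra.
  - specialize (HC n); pose proof (pow_lt (1 + 2 * beta) n ltac:(lra)).
    cbn [pow] in *; split; [lra|nra].
Qed.

Lemma Rabs_poch_le (a beta : R) (n : nat) : 0 < a -> 0 < beta ->
  Rabs (poch (beta - a) n) <= poch (a + beta) n.
Proof.
  intros Ha Hb; induction n as [|n IH]; simpl; [rewrite Rabs_R1; lra|].
  rewrite Rabs_mult; apply Rmult_le_compat; trivial using Rabs_pos.
  pose proof (pos_INR n); apply Rabs_le; lra.
Qed.

Lemma is_series_sqr (a beta z : R) : 0 < a -> 0 < beta ->
  is_series (fun n => sqr_coef a beta n * (- z / 4) ^ n *
      PSeries (coef01 (beta + INR n + 1 / 2)) (z / 4) ^ 2)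
    (PSeries (coef12 a (beta + 1 / 2) (a + beta)) z).
Proof.
  intros Ha Hb.
  set (b := beta + 1 / 2).
  set (G := fun n m => sqr_coef a beta n * (- / 4) ^ n * z ^ n *
    (coef12 (beta + INR n) (b + INR n) (2 * beta + INR (2 * n)) m * z ^ m)).
  apply (is_series_ext (fun n => Series (G n))).
  { intros n; pose proof (pos_INR n); unfold G; rewrite Series_scal_l.
    rewrite PSeries_coef01_sqr by lra.
    replace (4 * (z / 4)) with z by field.
    rewrite (Rmult_assoc (sqr_coef a beta n)), <- Rpow_mult_distr; unfold b.
    replace (- / 4 * z) with (- z / 4) by field.
    replace (beta + 1 / 2 + INR n) with (beta + INR n + 1 / 2) by ring.
    replace (2 * beta + INR (2 * n)) with (2 * (beta + INR n))
      by (rewrite mult_INR; simpl; ring).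
    reflexivity. }
  (* In [p] the quotient [(beta - a)_n / (a + beta)_n] is bounded by 1 in modulus. In [q] the
     dependence on [n] is gone: [(beta + n)_m <= (b + n)_m] and [(2 beta)_m <= (2 beta + 2 n)_m]. *)
  set (p := fun n => 2 / poch b n ^ 2 * ((1 + 2 * beta) * Rabs z / 4) ^ n).
  set (q := fun m => Rabs (coef01 (2 * beta) m * z ^ m)).
  apply (is_series_triangle G p q).
  - intros n; unfold p.
    pose proof (poch_pos b n ltac:(unfold b; lra)); pose proof (Rabs_pos z).
    apply Rmult_le_pos; [apply Rlt_le, Rdiv_lt_0_compat; [lra|now apply pow_lt]|].
    apply pow_le; nra.
  - intros m; apply Rabs_pos.
  - intros n m; unfold G, p, q; pose proof (pos_INR n).
    rewrite !Rabs_mult.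
    assert (H1 : Rabs (coef12 (beta + INR n) (b + INR n)
      (2 * beta + INR (2 * n)) m) <= Rabs (coef01 (2 * beta) m)).
    { pose proof (pos_INR (2 * n)).
      rewrite !Rabs_pos_eq by
        (apply Rlt_le; (apply coef12_pos || apply coef01_pos); unfold b; lra).
      unfold coef12, coef01.
      pose proof (poch_pos (beta + INR n) m ltac:(lra)).
      pose proof (poch_pos (b + INR n) m ltac:(unfold b; lra)).
      pose proof (poch_pos (2 * beta) m ltac:(lra)).
      pose proof (INR_fact_lt_0 m).
      pose proof (poch_le (beta + INR n) (b + INR n) m ltac:(unfold b; lra)).
      pose proof (poch_le (2 * beta) (2 * beta + INR (2 * n)) m ltac:(lra)).
      apply Rle_div_l; [repeat apply Rmult_lt_0_compat; lra|].
      rewrite Rmult_comm; apply Rle_div_r.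
      { apply Rmult_lt_0_compat; lra. }
      replace (INR (fact m) * poch (b + INR n) m * poch (2 * beta + INR (2 * n)) m)
        with (poch (b + INR n) m * (INR (fact m) * poch (2 * beta + INR (2 * n)) m))
        by ring.
      apply Rmult_le_compat; nra. }
    assert (H2 : Rabs (sqr_coef a beta n) <=
      2 / poch b n ^ 2 * (1 + 2 * beta) ^ n).
    { unfold sqr_coef; fold b.
      pose proof (weight_bounds beta n Hb) as Hw.
      pose proof (Rabs_poch_le a beta n Ha Hb).
      pose proof (poch_pos (a + beta) n ltac:(lra)).
      pose proof (poch_pos b n ltac:(unfold b; lra)) as Hbn.
      pose proof (pow_lt _ 2 Hbn).
      rewrite Rabs_div, !Rabs_mult by (apply Rgt_not_eq; nra).
      rewrite (Rabs_pos_eq (weight beta n)), (Rabs_pos_eq (poch (a + beta) n)),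
        (Rabs_pos_eq (poch b n ^ 2)) by lra.
      apply Rle_div_l; [nra|].
      replace (2 / poch b n ^ 2 * (1 + 2 * beta) ^ n *
        (poch (a + beta) n * poch b n ^ 2)) with
        (2 * (1 + 2 * beta) ^ n * poch (a + beta) n) by (field; lra).
      apply Rmult_le_compat; lra || apply Rabs_pos. }
    rewrite <- !RPow_abs, Rabs_Ropp, (Rabs_pos_eq (/ 4)) by lra.
    replace (((1 + 2 * beta) * Rabs z / 4) ^ n) with
      ((1 + 2 * beta) ^ n * ((/ 4) ^ n * Rabs z ^ n))
      by (rewrite <- !Rpow_mult_distr; f_equal; field).
    pose proof (pow_le _ n (Rabs_pos z)); pose proof (pow_le _ m (Rabs_pos z)).
    pose proof (pow_lt (/ 4) n ltac:(lra)).
    rewrite <- (Rmult_assoc (2 / _)), (Rmult_assoc (Rabs _) (_ ^ n) (_ ^ n)).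
    apply Rmult_le_compat; try (apply Rmult_le_compat_r; [nra|assumption]).
    + apply Rmult_le_pos; [apply Rabs_pos|nra].
    + apply Rmult_le_pos; [apply Rabs_pos|lra].
  - assert (Hbp : 0 < b) by (unfold b; lra).
    assert (HM : 0 < Rmin 1 b) by (apply Rmin_glb_lt; lra).
    pose proof (Rmin_l 1 b); pose proof (Rmin_r 1 b).
    (* Since [(k + 1) * Rmin 1 b <= b + k] and [b <= b + k], the quotient [(k + 1) / (b + k) ^ 2] is
       at most [M]. *)
    set (M := / (b * Rmin 1 b)).
    assert (HM0 : 0 < b * Rmin 1 b) by nra.
    assert (Hs : ex_series (fun n =>
      Rabs (2 / poch b n ^ 2 * ((1 + 2 * beta) * Rabs z / 4) ^ n))).
    { apply (ex_series_of_ratio (fun n => 2 / poch b n ^ 2) M).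
      { now apply Rlt_le, Rinv_0_lt_compat. }
      intros k; cbn [poch].
      pose proof (poch_pos b k Hbp); pose proof (pos_INR k).
      rewrite !Rabs_pos_eq by
        (apply Rlt_le, Rdiv_lt_0_compat; [|apply pow_lt]; nra).
      replace (2 / (poch b k * (b + INR k)) ^ 2) with
        (2 / poch b k ^ 2 * / (b + INR k) ^ 2) by (field; lra).
      replace ((INR k + 1) * (2 / poch b k ^ 2 * / (b + INR k) ^ 2)) with
        ((INR k + 1) * / (b + INR k) ^ 2 * (2 / poch b k ^ 2)) by ring.
      apply Rmult_le_compat_r; [apply Rlt_le, Rdiv_lt_0_compat; [|apply pow_lt]; lra|].
      unfold M; apply Rmult_le_reg_r with ((b + INR k) ^ 2 * (b * Rmin 1 b)); [apply Rmult_lt_0_compat; [apply pow_lt; lra|lra]|].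
      replace ((INR k + 1) * / (b + INR k) ^ 2 * ((b + INR k) ^ 2 * (b * Rmin 1 b)))
        with (b * ((INR k + 1) * Rmin 1 b)) by (field; lra).
      replace (/ (b * Rmin 1 b) * ((b + INR k) ^ 2 * (b * Rmin 1 b)))
        with ((b + INR k) * (b + INR k)) by (field; lra).
      apply Rmult_le_compat; nra. }
    now apply ex_series_Rabs in Hs.
  - apply CV_disk_inside, Rabs_lt_p_infty, CV_radius_coef01; lra.
  - apply (is_series_ext (fun k => coef12 a b (a + beta) k * z ^ k)).
    + intros k; unfold b; rewrite <- coef12_expansion, Rmult_comm, scal_sum by trivial.
      apply sum_eq; intros n Hn; unfold G, b.
      replace (z ^ k) with (z ^ n * z ^ (k - n))
        by (rewrite <- pow_add; f_equal; lia).
      ring.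
    + apply PSeries_correct_entire, CV_radius_coef12; unfold b; lra.
Qed.

(** At [z = - x ^ 2 / 4] the powers of [- z / 4] become powers of [x ^ 2 / 16], so the coefficients
    alone decide the signs of the terms. *)
Lemma F12_sqr_expansion (a b x : R) : 0 < a -> 1 / 2 < b ->
  is_series (fun n => sqr_coef a (b - 1 / 2) n * (x ^ 2 / 16) ^ n *
      BJ (b + INR n - 1) (x / 2) ^ 2) (F12 a b (a + b - 1 / 2) x).
Proof.
  intros Ha Hb; rewrite F12_PSeries.
  generalize (is_series_sqr a (b - 1 / 2) (- x ^ 2 / 4) Ha ltac:(lra)).
  replace (b - 1 / 2 + 1 / 2) with b by ring.
  replace (a + (b - 1 / 2)) with (a + b - 1 / 2) by ring.
  apply is_series_ext; intros n; rewrite BJ_PSeries.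
  replace (b - 1 / 2 + INR n + 1 / 2) with (b + INR n) by ring.
  replace (- (- x ^ 2 / 4) / 4) with (x ^ 2 / 16) by field.
  replace (- x ^ 2 / 4 / 4) with (- (x / 2) ^ 2 / 4) by field.
  reflexivity.
Qed.

Lemma F12_sub_sqr (a b x : R) : 0 < a -> 1 / 2 < b ->
  is_series (fun n => sqr_coef a (b - 1 / 2) (S n) * (x ^ 2 / 16) ^ S n *
      BJ (b + INR (S n) - 1) (x / 2) ^ 2)
    (F12 a b (a + b - 1 / 2) x - BJ (b - 1) (x / 2) ^ 2).
Proof.
  intros Ha Hb.
  pose proof (F12_sqr_expansion a b x Ha Hb) as H.
  apply (is_series_incr_1 (K := R_AbsRing) (V := R_NormedModule)
    (fun n => sqr_coef a (b - 1 / 2) n * (x ^ 2 / 16) ^ n *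
      BJ (b + INR n - 1) (x / 2) ^ 2)).
  replace (plus _ _) with (F12 a b (a + b - 1 / 2) x); [exact H|].
  unfold plus, sqr_coef, weight; simpl.
  replace (b + 0 - 1) with (b - 1) by ring; field.
Qed.

(** * Signs of the terms and the two implications *)

Lemma is_series_term_le (u : nat -> R) (l : R) (N : nat) :
  (forall n, 0 <= u n) -> is_series u l -> u N <= l.
Proof.
  intros Hu Hs; apply Rle_trans with (sum_n u N).
  - destruct N as [|N]; [rewrite sum_O; lra|].
    rewrite sum_Sn; unfold plus; simpl.
    rewrite sum_n_Reals; pose proof (cond_pos_sum u N Hu); lra.
  - apply (is_lim_seq_incr_compare (sum_n u)); [exact Hs|].
    intros n; rewrite sum_Sn; unfold plus; simpl; specialize (Hu (S n)); lra.
Qed.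

(** All terms are nonnegative, and strictness needs one positive term beyond the first. Once
    [N > x ^ 2 / 16], the Bessel function of order [b + N] is positive at [x / 2] by
    [PSeries_coef01_pos]. *)
Lemma sqr_lt_F12 (a b x : R) : 0 < a -> a + 1 / 2 < b -> 0 < x ->
  BJ (b - 1) (x / 2) ^ 2 < F12 a b (a + b - 1 / 2) x.
Proof.
  intros Ha Hab Hx.
  pose proof (F12_sub_sqr a b x Ha ltac:(lra)) as H.
  assert (Hc : forall n, 0 < sqr_coef a (b - 1 / 2) n).
  { intros n; apply Rdiv_lt_0_compat; apply Rmult_lt_0_compat;
      try apply pow_lt; try apply weight_bounds; try apply poch_pos; lra. }
  assert (Hy : 0 < x ^ 2 / 16) by nra.
  destruct (INR_unbounded (x ^ 2 / 16)) as [N HN].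
  apply (is_series_term_le _ _ N) in H.
  - assert (HB : 0 < BJ (b + INR (S N) - 1) (x / 2)).
    { rewrite BJ_PSeries.
      replace (- (x / 2) ^ 2 / 4) with (- (x ^ 2 / 16)) by field.
      apply PSeries_coef01_pos; rewrite S_INR; lra. }
    apply Rminus_lt_0; eapply Rlt_le_trans; [|exact H].
    apply Rmult_lt_0_compat; [|now apply pow_lt].
    apply Rmult_lt_0_compat; [trivial|now apply pow_lt].
  - intros n; apply Rmult_le_pos; [|apply pow2_ge_0].
    apply Rlt_le, Rmult_lt_0_compat; [trivial|now apply pow_lt].
Qed.

(** With [-1 < beta - a <= 0], the product [(beta - a)_(n+1)] has a nonpositive first factor and
    positive others. *)
Lemma F12_le_sqr (a b x : R) :
  0 < a -> 1 / 2 < b -> a - 1 / 2 < b <= a + 1 / 2 ->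
  F12 a b (a + b - 1 / 2) x <= BJ (b - 1) (x / 2) ^ 2.
Proof.
  intros Ha Hb Hab.
  set (u := fun n => sqr_coef a (b - 1 / 2) (S n) * (x ^ 2 / 16) ^ S n *
    BJ (b + INR (S n) - 1) (x / 2) ^ 2).
  assert (Hu : forall n, 0 <= - u n).
  { intros n; unfold u, sqr_coef; rewrite poch_S_l.
    pose proof (weight_bounds (b - 1 / 2) (S n) ltac:(lra)).
    pose proof (poch_pos (b - 1 / 2 - a + 1) n ltac:(lra)).
    pose proof (poch_pos (a + (b - 1 / 2)) (S n) ltac:(lra)).
    pose proof (poch_pos (b - 1 / 2 + 1 / 2) (S n) ltac:(lra)).
    set (d := poch (a + _) _ * _ ^ 2).
    assert (Hd : 0 < d) by (apply Rmult_lt_0_compat; [|apply pow_lt]; lra).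
    set (w := weight _ _) in *; set (p := poch (_ + 1) n) in *.
    set (y := (x ^ 2 / 16) ^ S n); set (v := BJ _ _ ^ 2).
    replace (- (w * ((b - 1 / 2 - a) * p) / d * y * v)) with
      (w * ((a + 1 / 2 - b) * p) / d * y * v) by (field; lra).
    apply Rmult_le_pos; [|apply pow2_ge_0].
    apply Rmult_le_pos; [|apply pow_le; nra].
    apply Rmult_le_pos; [|now apply Rlt_le, Rinv_0_lt_compat].
    apply Rmult_le_pos; [lra|apply Rmult_le_pos; lra]. }
  pose proof (F12_sub_sqr a b x Ha Hb) as H.
  apply is_series_opp, (is_series_term_le _ _ 0 Hu) in H.
  specialize (Hu 0%nat).
  change (opp ?z) with (- z) in H; lra.
Qed.

Lemma not_P12_base (a b : R) :
  a - 1 / 2 < b <= a + 1 / 2 -> ~ P12 a b (a + b - 1 / 2).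
Proof.
  intros Hab H; destruct (Rle_or_lt b (1 / 2)) as [Hb|Hb].
  { exact (P12_small a b Hb H). }
  destruct (PSeries_coef01_zero b ltac:(lra)) as [y [Hy Hz]].
  pose proof (sqrt_lt_R0 y Hy).
  (* At [x = 4 sqrt y] the Bessel function is taken at [x / 2 = 2 sqrt y], that is, at [z = - y],
     where it vanishes. *)
  destruct H as (Ha & _ & _ & HF); specialize (HF (4 * sqrt y) ltac:(lra)).
  pose proof (F12_le_sqr a b (4 * sqrt y) Ha Hb Hab) as Hle.
  rewrite BJ_PSeries in Hle.
  replace (- (4 * sqrt y / 2) ^ 2 / 4) with (- y) in Hle.
  - rewrite Hz in Hle; simpl in Hle; lra.
  - replace (4 * sqrt y / 2) with (2 * sqrt y) by field.
    rewrite Rpow_mult_distr, pow2_sqrt by lra; field.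
Qed.

(** Here [m] bounds the number of unit steps that bring [b] above [a - 1 / 2]. Raising both lower
    parameters by 1 keeps [c = a + b - 1 / 2]; for [b <= a - 1 / 2] the induction hypothesis at
    [b + 1] then gives the absurd [a + 1 / 2 < b + 1]. *)
Lemma P12_necessary (a b : R) : P12 a b (a + b - 1 / 2) -> a + 1 / 2 < b.
Proof.
  destruct (INR_unbounded (a - 1 / 2 - b)) as [m Hm].
  revert b Hm; induction m as [|m IH]; intros b Hm H;
    (destruct (Rlt_or_le (a + 1 / 2) b) as [|Hb]; trivial); exfalso.
  - simpl in Hm; apply (not_P12_base a b); trivial; lra.
  - destruct (Rlt_or_le (a - 1 / 2) b) as [Hb'|Hb'].
    + apply (not_P12_base a b); trivial; lra.
    + rewrite S_INR in Hm.
      assert (a + 1 / 2 < b + 1); [|lra].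
      apply IH; [lra|].
      replace (a + (b + 1) - 1 / 2) with (a + b - 1 / 2 + 1) by ring.
      now apply P12_step, P12_sym, P12_step, P12_sym.
Qed.

Theorem theorem4 (a b : R) (ha : 0 < a) (hb : 0 < b) :
  (P12 a b (a + b - 1/2) <-> a + 1/2 < b) /\
  (a + 1/2 < b ->
   forall x : R, 0 < x -> (BJ (b - 1) (x / 2)) ^ 2 < F12 a b (a + b - 1/2) x).
Proof.
  split; [split|].
  - apply P12_necessary.
  - intros Hab; repeat split; try lra.
    intros x Hx; apply Rle_lt_trans with (BJ (b - 1) (x / 2) ^ 2).
    + apply pow2_ge_0.
    + now apply sqr_lt_F12.
  - intros Hab x Hx; now apply sqr_lt_F12.
Qed.
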